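(* Let $H\in C^2(\mathbb R^d\times\mathbb R^d;\mathbb R)$, $H=H(p,x)$, be $\mathbb Z^d$-periodic in $x$, with $D^2_{pp}H>0$ and $\lim_{|p|\to+\infty}|p|^{-1}H(p,x)=+\infty$ uniformly in $x$. Let $(\Omega,\mathcal F,\mathbb P)$ be a probability space with a measure preserving and ergodic action $(\tau_k)_{k\in\mathbb Z^d}$ of $(\mathbb Z^d,+)$, and let $f:\mathbb R^d\times\Omega\to\mathbb R$ be a random potential which is nonnegative, continuous with respect to the first variable uniformly with respect to the second variable, and $\mathbb Z^d$-stationary, i.e. $f(x+k,\omega)=f(x,\tau_k\omega)$ for all $x\in\mathbb R^d$, $k\in\mathbb Z^d$, $\omega\in\Omega$. Let $\overline H$ be the effective constant of $H$ and $\overline H_f$ the ergodic constant of $H(p,x)-f(x,\omega)$. Then $$0\le\overline H-\overline H_f\le\sup_{x\in\mathbb R^d}\mathbb E[f(x,\cdot)] .$$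
   Context: Hamilton-Jacobi equations are understood in the viscosity sense. Measure preserving: $\mathbb P[\tau_kA]=\mathbb P[A]$ for all $k\in\mathbb Z^d$, $A\in\mathcal F$. Ergodic: every translation invariant $A\in\mathcal F$ has $\mathbb P[A]\in\{0,1\}$. $\overline H$ is the unique constant for which $H(D\chi,x)=\overline H$ in $\mathbb R^d$ has a continuous $\mathbb Z^d$-periodic solution $\chi$. $\overline H_f$ is the (deterministic) almost sure limit $\overline H_f=\lim_{\delta\to0}-\delta v^\delta(0)$, where $v^\delta$ is the bounded, Lipschitz continuous (with a constant independent of $\delta$), $\mathbb Z^d$-stationary solution of the discounted problem $\delta v^\delta+H(Dv^\delta,x)-f=0$ in $\mathbb R^d$; the existence of $v^\delta$ and of this limit is part of the setting. *)

(* Defs.v *)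
From HB Require Import structures.
From mathcomp Require Import all_boot all_order all_algebra.
From mathcomp Require Import all_classical all_reals all_analysis.

Set Implicit Arguments.
Unset Strict Implicit.
Unset Printing Implicit Defensive.
Import Order.TTheory GRing.Theory Num.Theory.
Import numFieldNormedType.Exports.
Local Open Scope classical_set_scope.
Local Open Scope ring_scope.

(* R^d is 'rV[R]_d. Its library norm is the sup norm; coercivity, Lipschitz
   continuity, boundedness and local maxima do not depend on the norm chosen. *)

(* The quantification over all directions v amounts to continuity of the
   partial derivatives, the spaces below being finite dimensional. *)
Definition is_C1 (R : realType) (V : normedModType R) (f : V -> R) : Prop :=
  (forall x, differentiable f x) /\ (forall v, continuous ('D_v f)).

Definition is_C2 (R : realType) (V : normedModType R) (f : V -> R) : Prop :=
  is_C1 f /\ (forall v, is_C1 ('D_v f)).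

Definition grad (R : realType) (d : nat) (f : 'rV[R]_d -> R) (x : 'rV[R]_d) :
  'rV[R]_d := \row_i 'D_(delta_mx 0 i) f x.

Definition hessian (R : realType) (d : nat) (f : 'rV[R]_d -> R)
    (x : 'rV[R]_d) : 'M[R]_d :=
  \matrix_(i, j) 'D_(delta_mx 0 i) ('D_(delta_mx 0 j) f) x.

Definition posdef (R : realType) (d : nat) (A : 'M[R]_d) : Prop :=
  forall xi : 'rV[R]_d, xi != 0 -> 0 < (xi *m A *m xi^T) 0 0.

Definition intvec (R : realType) (d : nat) (k : 'rV[int]_d) : 'rV[R]_d :=
  map_mx intr k.
Arguments intvec R {d} k.

Definition Zd_periodic (R : realType) (d : nat) (u : 'rV[R]_d -> R) : Prop :=
  forall x k, u (x + intvec R k) = u x.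

Definition superlinear (R : realType) (d : nat)
    (H : 'rV[R]_d -> 'rV[R]_d -> R) : Prop :=
  forall M : R, exists2 r : R, 0 < r &
    forall p x, r <= `|p| -> M <= `|p|^-1 * H p x.

(* Continuous viscosity solutions of F (u x) (Du x) x = 0 in R^d. *)
Section viscosity.
Context {R : realType} {d : nat}.
Implicit Types (F : R -> 'rV[R]_d -> 'rV[R]_d -> R) (u : 'rV[R]_d -> R).

Definition viscosity_subsolution F u : Prop :=
  forall (phi : 'rV[R]_d -> R) (x0 : 'rV[R]_d), is_C1 phi ->
    (\forall y \near x0, u y - phi y <= u x0 - phi x0) ->
    F (u x0) (grad phi x0) x0 <= 0.

Definition viscosity_supersolution F u : Prop :=
  forall (phi : 'rV[R]_d -> R) (x0 : 'rV[R]_d), is_C1 phi ->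
    (\forall y \near x0, u x0 - phi x0 <= u y - phi y) ->
    0 <= F (u x0) (grad phi x0) x0.

Definition viscosity_solution F u : Prop :=
  [/\ continuous u, viscosity_subsolution F u & viscosity_supersolution F u].

End viscosity.

Definition has_corrector (R : realType) (d : nat)
    (H : 'rV[R]_d -> 'rV[R]_d -> R) (c : R) : Prop :=
  exists chi : 'rV[R]_d -> R,
    Zd_periodic chi /\ viscosity_solution (fun _ p x => H p x - c) chi.

Definition is_effective_constant (R : realType) (d : nat)
    (H : 'rV[R]_d -> 'rV[R]_d -> R) (c : R) : Prop :=
  has_corrector H c /\ (forall c', has_corrector H c' -> c' = c).

Section random.
Context {R : realType} {d : nat} {disp : measure_display}.
Context {Omega : measurableType disp}.

Definition measure_preserving_action (P : probability Omega R)
    (tau : 'rV[int]_d -> Omega -> Omega) : Prop :=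
  [/\ forall w, tau 0 w = w,
      forall k l w, tau (k + l) w = tau k (tau l w),
      forall k, measurable_fun setT (tau k) &
      forall k (A : set Omega), measurable A -> P (tau k @` A) = P A].

Definition ergodic_action (P : probability Omega R)
    (tau : 'rV[int]_d -> Omega -> Omega) : Prop :=
  forall A : set Omega, measurable A -> (forall k, tau k @` A = A) ->
    P A = 0%E \/ P A = 1%E.

Definition Zd_stationary (tau : 'rV[int]_d -> Omega -> Omega)
    (u : 'rV[R]_d -> Omega -> R) : Prop :=
  forall x k w, u (x + intvec R k) w = u x (tau k w).

Definition random_field (u : 'rV[R]_d -> Omega -> R) : Prop :=
  forall x, measurable_fun setT (u x).

Definition continuous_uniformly_in_omega (u : 'rV[R]_d -> Omega -> R) : Prop :=
  forall (x : 'rV[R]_d) (e : R), 0 < e ->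
    \forall y \near x, forall w, `|u y w - u x w| < e.

(* v delta x w stands for v^delta(x, w). The bound may depend on delta and w;
   the Lipschitz constant may depend on w, but not on delta. *)
Definition discounted_solutions (tau : 'rV[int]_d -> Omega -> Omega)
    (H : 'rV[R]_d -> 'rV[R]_d -> R) (f : 'rV[R]_d -> Omega -> R)
    (v : R -> 'rV[R]_d -> Omega -> R) : Prop :=
  [/\ forall delta : R, 0 < delta -> random_field (v delta),
      forall delta : R, 0 < delta -> Zd_stationary tau (v delta),
      forall (delta : R) w, 0 < delta -> bounded_fun (fun x => v delta x w),
      forall w, exists L : R, forall delta : R, 0 < delta ->
        L.-lipschitz (fun x => v delta x w) &
      forall (delta : R) w, 0 < delta ->
        viscosity_solution (fun r p x => delta * r + H p x - f x w)
          (fun x => v delta x w)].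

Definition is_ergodic_constant (P : probability Omega R)
    (tau : 'rV[int]_d -> Omega -> Omega)
    (H : 'rV[R]_d -> 'rV[R]_d -> R) (f : 'rV[R]_d -> Omega -> R)
    (c : R) : Prop :=
  exists v : R -> 'rV[R]_d -> Omega -> R,
    discounted_solutions tau H f v /\
    {ae P, forall w, (- (delta * v delta 0 w)) @[delta --> 0^'+] --> c}.

End random.

(* Main.v *)
(* Write v for v^delta and chi for the corrector. Doubling the variables in
   chi(x) - v(y) - a|x - y|^2, at approximate maxima so that no localisation is
   needed, gives - delta v <= Hbar + 2 delta |chi|, hence Hbarf <= Hbar.

   For the other inequality, v is by ergodicity almost surely bounded and
   Lipschitz with deterministic constants. Take an approximate maximiser (y, X),
   among points y and random points X, of
     E[v(X) - a|X - y|^2] - chi(y).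
   For almost every w a paraboloid of gradient q(w) = 2a(X(w) - y) touches
   v(., w) from above near X(w), and a paraboloid of gradient E[q] touches chi
   from below near y. Up to errors, Jensen's inequality then yields
     Hbar <= H(E[q], y) <= E[H(q, y)] <= E[f(y)] - delta E[v(X)],
   that is E[- delta v(0)] >= Hbar - sup E[f] - o(1), and Fatou's lemma
   concludes. *)
Require Import Defs.
From HB Require Import structures.
From mathcomp Require Import all_boot all_order all_algebra.
From mathcomp Require Import all_classical all_reals all_analysis.
From mathcomp Require Import ring lra.
From mathcomp Require Import measurable_realfun.
Set Implicit Arguments.
Unset Strict Implicit.
Unset Printing Implicit Defensive.
Import Order.TTheory GRing.Theory Num.Theory.
Import numFieldNormedType.Exports.
Local Open Scope classical_set_scope.
Local Open Scope ring_scope.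

(** * Quadratic test functions *)

(** The square of the Euclidean norm. The ambient norm is the sup norm, which is not smooth, so
    penalisations and test functions are built on this form. *)
Definition sqnorm (R : realType) (d : nat) (x : 'rV[R]_d) : R :=
  \sum_i x 0 i ^+ 2.

Lemma continuous_sum (R : realType) (T : topologicalType) (n : nat)
    (F : 'I_n -> T -> R) :
  (forall i, continuous (F i)) -> continuous (fun x => \sum_i F i x).
Proof.
move=> cF x; apply: (@cvg_big _ _ _ _ _ _ _ (nbhs x)) => [|i _].
  exact: add_continuous.
exact: cF.
Qed.

Section quadratic.
Context {R : realType} {d : nat}.
Implicit Types x y z c v : 'rV[R]_d.

Lemma normr_coord_le x i : `|x 0 i| <= `|x|.
Proof.
rewrite [leRHS]/Num.norm /= mx_normrE; apply/bigmax_geP; right => /=.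
by exists (ord0, i).
Qed.

Lemma norm_rowP x (e : R) : 0 < e -> (forall i, `|x 0 i| < e) -> `|x| < e.
Proof.
move=> e0 xe; rewrite [ltLHS]/Num.norm /= mx_normrE; apply/bigmax_ltP; split => //.
by move=> [i j] _ /=; rewrite ord1.
Qed.

Lemma norm_row_leP x (e : R) : 0 <= e -> (forall i, `|x 0 i| <= e) -> `|x| <= e.
Proof.
move=> e0 xe; rewrite [leLHS]/Num.norm /= mx_normrE; apply/bigmax_leP; split => //.
by move=> [i j] _ /=; rewrite ord1.
Qed.

Lemma sqnorm_ge0 x : 0 <= sqnorm x.
Proof. by apply: sumr_ge0 => i _; exact: sqr_ge0. Qed.

Lemma sqnorm0 : sqnorm (0 : 'rV[R]_d) = 0.
Proof. by rewrite /sqnorm big1// => i _; rewrite mxE expr0n. Qed.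

Lemma sqnormB x y : sqnorm (x - y) = sqnorm (y - x).
Proof. by rewrite /sqnorm; apply: eq_bigr => i _; rewrite !mxE; ring. Qed.

Lemma norm_le_sqnorm x : `|x| ^+ 2 <= sqnorm x.
Proof.
have : mx_norm x = `|x| by [].
have [->|x0] := eqVneq `|x| 0; first by rewrite expr0n/= sqnorm_ge0.
move=> nx; have [|[i j] /=] := @mx_norm_neq0 _ _ _ x; first by rewrite nx.
rewrite ord1 nx => ->; rewrite real_normK ?num_real//.
rewrite /sqnorm (bigD1 j)//= lerDl.
by apply: sumr_ge0 => k _; exact: sqr_ge0.
Qed.

Lemma sqnorm_sub_le x y :
  `|sqnorm x - sqnorm y| <= d%:R * (`|x - y| * (`|x| + `|y|)).
Proof.
rewrite /sqnorm -sumrB (le_trans (ler_norm_sum _ _ _))//.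
have -> : d%:R * (`|x - y| * (`|x| + `|y|)) =
    \sum_(i < d) (`|x - y| * (`|x| + `|y|)).
  by rewrite sumr_const card_ord mulr_natl.
apply: ler_sum => i _; rewrite subr_sqr normrM ler_pM//.
  by have := normr_coord_le (x - y) i; rewrite !mxE.
by rewrite (le_trans (ler_normD _ _))// lerD// normr_coord_le.
Qed.

Lemma coordB_continuous c i : continuous (fun y : 'rV[R]_d => (y - c) 0 i).
Proof.
move=> y; apply: (@continuous_comp _ _ _ (fun z : 'rV_d => z - c)
  (fun z : 'rV_d => z 0 i)); last exact: coord_continuous.
exact: (cvgB cvg_id (cvg_cst c)).
Qed.

Lemma is_derive_coord (i : 'I_d) x v :
  is_derive x v (fun y => y 0 i : R) (v 0 i).
Proof.
apply: DeriveDef; first exact/diff_derivable/differentiable_coord.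
rewrite deriveE; last exact: differentiable_coord.
(* The coordinate map is rebuilt as a bundled linear map, so that [diff_lin] computes its
   differential. *)
have @l : {linear 'rV[R]_d -> R}.
  by exists (fun N : 'rV[R]_d => N 0 i); do 2![eexists]; do ?[constructor];
     rewrite ?mxE// => ? *; rewrite ?mxE//; move=> ?; rewrite !mxE.
rewrite (_ : (fun y : 'rV_d => y 0 i) = l)// diff_lin//.
exact: coord_continuous.
Qed.

Lemma is_derive_sqnormB x c v :
  is_derive x v (fun y => sqnorm (y - c)) (\sum_i 2 * (x - c) 0 i * v 0 i).
Proof.
have -> : (fun y => sqnorm (y - c)) =
    \sum_(i < d) ((fun y : 'rV[R]_d => y 0 i) - cst (c 0 i)) ^+ 2.
  apply/funext => y; rewrite fct_sumE; apply: eq_bigr => i _.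
  by rewrite !mxE expr2.
have H i := @is_deriveX _ _ _ 2 x v _
  (is_deriveB (is_derive_coord i x v) (is_derive_cst (c 0 i) x v)).
apply: (is_derive_eq (is_derive_sum H)); apply: eq_bigr => i _.
by rewrite !mxE subr0 /= expr1 /GRing.scale/=; congr (_ * _).
Qed.

Lemma differentiable_sqnormB x c : differentiable (fun y => sqnorm (y - c)) x.
Proof.
have -> : (fun y => sqnorm (y - c)) =
    \sum_(i < d) ((fun y : 'rV[R]_d => y 0 i) - cst (c 0 i)) ^+ 2.
  apply/funext => y; rewrite fct_sumE; apply: eq_bigr => i _.
  by rewrite !mxE expr2.
apply: differentiable_sum => i; apply: differentiableX.
by apply: differentiableB; [exact: differentiable_coord|exact: differentiable_cst].
Qed.

(** Two centres are needed: one for the penalisation of the doubling, one for the perturbation that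
    turns an approximate extremum into an exact one. *)
Definition quad (a : R) c (b : R) e : 'rV[R]_d -> R :=
  fun y => a * sqnorm (y - c) + b * sqnorm (y - e).

Lemma is_derive_quad a c b e x v : is_derive x v (quad a c b e)
  (\sum_i (2 * a * (x - c) 0 i + 2 * b * (x - e) 0 i) * v 0 i).
Proof.
apply: (is_derive_eq (is_deriveD (is_deriveZ a (is_derive_sqnormB x c v))
  (is_deriveZ b (is_derive_sqnormB x e v)))); rewrite !scaler_sumr -big_split/=.
by apply: eq_bigr => i _; rewrite /GRing.scale/=; ring.
Qed.

Lemma is_C1_quad a c b e : is_C1 (quad a c b e).
Proof.
split.
  move=> x; apply: differentiableD; apply: differentiableZ;
    exact: differentiable_sqnormB.
move=> v; have -> : 'D_v (quad a c b e) =
    (fun x => \sum_i (2 * a * (x - c) 0 i + 2 * b * (x - e) 0 i) * v 0 i).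
  by apply/funext => x; apply: derive_val; exact: is_derive_quad.
apply: continuous_sum => i x.
exact: (cvgMr_tmp (cvgD (cvgMl_tmp (@coordB_continuous c i x))
  (cvgMl_tmp (@coordB_continuous e i x)))).
Qed.

Lemma grad_quad a c b e x :
  grad (quad a c b e) x = (2 * a) *: (x - c) + (2 * b) *: (x - e).
Proof.
apply/rowP => j; rewrite !mxE.
rewrite (@derive_val _ _ _ _ _ _ _ (is_derive_quad a c b e x (delta_mx 0 j))).
rewrite (bigD1 j)//= big1 ?addr0 => [|i ij].
  by rewrite !mxE !eqxx mulr1.
by rewrite !mxE (negbTE ij) andbF mulr0.
Qed.

End quadratic.

(** * Compactness and approximate extrema *)

Section compactness.
Context {R : realType} {d : nat}.
Implicit Types x y z c v : 'rV[R]_d.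

Lemma compact_norm_ball y (r : R) : compact [set x | `|x - y| <= r].
Proof.
apply: bounded_closed_compact.
  exists (r + `|y|); split; first exact: num_real.
  move=> M rM x /= xy; rewrite (le_trans _ (ltW rM))//.
  by rewrite -[x in leLHS](subrK y) (le_trans (ler_normD _ _))// lerD2r.
rewrite (_ : [set x | _] = (fun x => `|x - y|) @^-1` [set t | t <= r]) //.
apply: closed_comp; last exact: closed_le.
move=> x _; apply: (@continuous_comp _ _ _ (fun z => z - y)
  (fun z : 'rV_d => `|z|)); last exact: norm_continuous.
exact: (cvgB cvg_id (cvg_cst y)).
Qed.

Lemma finite_net y (r h : R) : 0 < h -> exists n (g : 'I_n.+1 -> 'rV[R]_d),
  forall x, `|x - y| <= r -> exists i, `|x - g i| < h.
Proof.
move=> h0; have := @compact_norm_ball y r; rewrite compact_cover.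
move=> /(_ _ setT (fun z => ball z h)) [].
- by move=> z _; exact: ball_open.
- by move=> x _; exists x => //; exact: ballxx.
move=> D _ Dcov.
(* The additional last index takes the default value [y], so the index type is never empty. *)
exists (size (finmap.enum_fset D)), (fun i => nth y (finmap.enum_fset D) i).
move=> x /Dcov[z /= zD].
rewrite -ball_normE /= => zx.
have zs : (index z (finmap.enum_fset D) < (size (finmap.enum_fset D)).+1)%N.
  by rewrite ltnS index_size.
by exists (Ordinal zs) => /=; rewrite nth_index// distrC.
Qed.

(** Subtract the integer part of each coordinate. Periodic and stationary questions are thereby
    reduced to a compact ball. *)
Lemma translate_to_unit_cube x : exists k, `|x + intvec R k| <= 1.
Proof.
exists (\row_i - Num.floor (x 0 i)); apply: norm_row_leP => // i.
rewrite !mxE intrN.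
have := floor_itv (x 0 i); rewrite intrD => /andP[l1 l2].
by rewrite ger0_norm; lra.
Qed.

Lemma periodic_bounded (u : 'rV[R]_d -> R) : Zd_periodic u -> continuous u ->
  exists C : R, 0 <= C /\ forall x, `|u x| <= C.
Proof.
move=> uper ucont.
have [c _ cmax] : exists2 c, c \in [set x | `|x - 0| <= 1] &
    forall t, t \in [set x | `|x - 0| <= 1] -> `|u t| <= `|u c|.
  apply: (@EVT_max_rV _ _ (fun x => `|u x|)).
  - by exists 0; rewrite /= subr0 normr0.
  - exact: compact_norm_ball.
  - apply: continuous_subspaceT => x.
    apply: (@continuous_comp _ _ _ u (fun t : R => `|t|)); first exact: ucont.
    exact: norm_continuous.
exists `|u c|; split=> [//|x].
have [k xk] := translate_to_unit_cube x.
by rewrite -(uper x k); apply: cmax; apply/mem_set; rewrite /= subr0.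
Qed.

(* Adding |y - y0|^2 turns an eta-minimum at y0 into an exact local minimum at
   distance less than r, since eta < r^2. *)
Lemma perturbed_minimum (u : 'rV[R]_d -> R) (a : R) c y0 (r eta : R) :
  0 < r -> eta < r ^+ 2 -> continuous u ->
  (forall y, u y0 + a * sqnorm (y0 - c) - eta <= u y + a * sqnorm (y - c)) ->
  exists y, [/\ `|y - y0| < r,
    u y + a * sqnorm (y - c) <= u y0 + a * sqnorm (y0 - c) &
    \forall z \near y, u y + a * sqnorm (y - c) + sqnorm (y - y0) <=
                       u z + a * sqnorm (z - c) + sqnorm (z - y0)].
Proof.
move=> r0 etar ucont umin.
pose g z := u z + a * sqnorm (z - c) + sqnorm (z - y0).
have sqc e : continuous (fun z : 'rV[R]_d => sqnorm (z - e)).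
  by move=> z; apply/differentiable_continuous/differentiable_sqnormB.
have gcont : continuous g.
  move=> z; apply: (@cvgD _ _ _ (nbhs z)); last exact: sqc.
  apply: (@cvgD _ _ _ (nbhs z)); first exact: ucont.
  by apply: cvgMl_tmp; exact: sqc.
have [y yB ymin] : exists2 y, y \in [set x | `|x - y0| <= r] &
    forall t, t \in [set x | `|x - y0| <= r] -> g y <= g t.
  apply: EVT_min_rV.
  - by exists y0; rewrite /= subrr normr0 ltW.
  - exact: compact_norm_ball.
  - exact: continuous_subspaceT.
have gy0 : g y <= g y0 by apply: ymin; apply/mem_set; rewrite /= subrr normr0 ltW.
have gy0E : g y0 = u y0 + a * sqnorm (y0 - c) by rewrite /g subrr sqnorm0 addr0.
have yr : `|y - y0| < r.
  rewrite -ltr_sqr ?nnegrE ?(ltW r0)//.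
  have := norm_le_sqnorm (y - y0); have := umin y.
  by move: gy0; rewrite gy0E /g; lra.
exists y; split => //.
  have := sqnorm_ge0 (y - y0).
  by move: gy0; rewrite gy0E /g; lra.
have : \forall z \near y, `|z - y| < r - `|y - y0|.
  apply/nbhs_normP; exists (r - `|y - y0|); first by rewrite /= subr_gt0.
  by move=> z /=; rewrite distrC.
apply: filterS => z zy; apply: ymin; apply/mem_set; rewrite /=.
have -> : z - y0 = (z - y) + (y - y0) by rewrite addrA subrK.
by rewrite (le_trans (ler_normD _ _))//; lra.
Qed.

(** At the perturbed minimum, [u] is touched from below by a concave quadratic, whose gradient is
    the slope in the conclusion. The term [2 *: (y - y0)] is the cost of the perturbation, of norm
    less than [2 * r]. *)
Lemma supersolution_near_minimum (F : R -> 'rV[R]_d -> 'rV[R]_d -> R)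
    (u : 'rV[R]_d -> R) (a : R) c y0 (r eta : R) :
  0 < r -> eta < r ^+ 2 -> continuous u -> viscosity_supersolution F u ->
  (forall y, u y0 + a * sqnorm (y0 - c) - eta <= u y + a * sqnorm (y - c)) ->
  exists y, [/\ `|y - y0| < r,
    u y + a * sqnorm (y - c) <= u y0 + a * sqnorm (y0 - c) &
    0 <= F (u y) ((- (2 * a)) *: (y - c) - 2 *: (y - y0)) y].
Proof.
move=> r0 etar ucont usuper umin.
have [y [yr uy near_y]] := perturbed_minimum r0 etar ucont umin.
exists y; split => //.
have := usuper (quad (- a) c (- 1) y0) y (is_C1_quad _ _ _ _).
rewrite grad_quad !mulrN mulr1 [(- 2) *: _]scaleNr; apply.
by apply: filterS near_y => z; rewrite /quad; lra.
Qed.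

Lemma subsolution_near_maximum (F : R -> 'rV[R]_d -> 'rV[R]_d -> R)
    (u : 'rV[R]_d -> R) (a : R) c y0 (r eta : R) :
  0 < r -> eta < r ^+ 2 -> continuous u -> viscosity_subsolution F u ->
  (forall y, u y - a * sqnorm (y - c) <= u y0 - a * sqnorm (y0 - c) + eta) ->
  exists y, [/\ `|y - y0| < r,
    u y0 - a * sqnorm (y0 - c) <= u y - a * sqnorm (y - c) &
    F (u y) ((2 * a) *: (y - c) + 2 *: (y - y0)) y <= 0].
Proof.
move=> r0 etar ucont usub umax.
have [||y [yr uy near_y]] := @perturbed_minimum (\- u) a c y0 r eta r0 etar.
- by move=> x; exact: (cvgN (ucont x)).
- by move=> y /=; have := umax y; lra.
move: uy near_y => /= uy near_y.
exists y; split => //; first by lra.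
have := usub (quad a c 1 y0) y (is_C1_quad _ _ _ _).
rewrite grad_quad mulr1; apply.
by apply: filterS near_y => z; rewrite /quad; lra.
Qed.

End compactness.

(** * Uniform moduli of continuity *)

(** The parameter [i] carries the uniformity in the random variable. Only [x] is confined to [K].
    Around each point of [K], half of a radius of continuity is spent on moving [x] and half on the
    distance from [x] to [y]; compactness then gives a common [rho]. *)
Lemma compact_uniform_modulus (R : realType) (V : normedModType R) (I : Type)
    (g : V -> I -> R) (K : set V) : compact K ->
  (forall x (e : R), 0 < e -> \forall y \near x, forall i, `|g y i - g x i| < e) ->
  forall e : R, 0 < e -> exists2 rho : R, 0 < rho &
    forall x y, K x -> `|x - y| < rho -> forall i, `|g y i - g x i| < e.
Proof.
move=> /compact_near_coveringP cK gcont e e0.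
pose P (rho : R) x := forall y, `|x - y| < rho -> forall i, `|g y i - g x i| < e.
have : \forall rho \near 0^'+, K `<=` P rho.
  apply: (cK R (0^'+) P _) => x Kx.
  have e20 : 0 < e / 2 by rewrite divr_gt0.
  have /nbhs_normP[s /= s0 sg] := gcont x _ e20.
  have s20 : 0 < s / 2 by rewrite divr_gt0.
  near=> x' rho => y /= x'y i.
  have xx' : `|x - x'| < s / 2.
    by near: x'; apply/nbhs_normP; exists (s / 2).
  have rs : rho < s / 2 by near: rho; exact: nbhs_right_lt.
  have h1 : `|g x' i - g x i| < e / 2 by apply: sg => /=; lra.
  have h2 : `|g y i - g x i| < e / 2.
    by apply: sg => /=; rewrite (le_lt_trans (ler_distD x' _ _))//; lra.
  rewrite (le_lt_trans (ler_distD (g x i) _ _))//.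
  by rewrite (distrC (g x i)); lra.
move=> nearP.
have : \forall rho \near (0:R)^'+, 0 < rho /\ K `<=` P rho.
  by apply: filterI => //; exact: nbhs_right_gt.
by move=> /filter_ex[rho [rho0 KP]]; exists rho => // x y Kx xy i; exact: KP.
Unshelve. all: by end_near. Qed.

Section moduli.
Context {R : realType} {d : nat}.

(** Compactness comes from the bound on [p] and, for [x], from periodicity: one integer translation,
    applied to both [x] and [y], brings [x] into the unit ball. *)
Lemma hamiltonian_uniform_modulus (H : 'rV[R]_d -> 'rV[R]_d -> R) :
  continuous (fun px : 'rV[R]_d * 'rV[R]_d => H px.1 px.2) ->
  (forall p, Zd_periodic (H p)) ->
  forall K e : R, 0 < e -> exists2 rho : R, 0 < rho &
    forall p q x y, `|p| <= K -> `|p - q| < rho -> `|x - y| < rho ->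
      `|H q y - H p x| < e.
Proof.
move=> Hcont Hper K e e0.
have [] := @compact_uniform_modulus R ('rV[R]_d * 'rV[R]_d)%type unit
  (fun px _ => H px.1 px.2)
  ([set p | `|p - 0| <= K] `*` [set x | `|x - 0| <= 1]) _ _ e e0.
- by apply: compact_setX; exact: compact_norm_ball.
- move=> px t t0; have := Hcont px.
  by move=> /cvgr_distC_lt /(_ _ t0); apply: filterS => py + _; rewrite distrC.
move=> rho rho0 rhoP; exists rho => // p q x y pK pq xy.
have [k xk] := translate_to_unit_cube x.
have := rhoP (p, x + intvec R k) (q, y + intvec R k) _ _ tt.
rewrite /= !Hper; apply; first by rewrite /= !subr0.
rewrite prod_normE /= opprD addrACA subrr addr0.
by rewrite gt_max pq.
Qed.

(** A translation by [k] brings [x] into the unit ball and is compensated by replacing [w] with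
    [tau (- k) w]. This is harmless since the modulus on the ball is uniform in [w]. *)
Lemma stationary_uniform_modulus (disp : measure_display)
    (Omega : measurableType disp) (tau : 'rV[int]_d -> Omega -> Omega)
    (f : 'rV[R]_d -> Omega -> R) :
  Zd_stationary tau f -> continuous_uniformly_in_omega f ->
  (forall w, tau 0 w = w) ->
  (forall (k l : 'rV[int]_d) w, tau (k + l) w = tau k (tau l w)) ->
  forall e : R, 0 < e -> exists2 rho : R, 0 < rho &
    forall x y w, `|x - y| < rho -> `|f y w - f x w| < e.
Proof.
move=> fstat fcont tau0 tauD e e0.
have [] := @compact_uniform_modulus R 'rV[R]_d Omega f
  [set x | `|x - 0| <= 1] _ fcont e e0.
  exact: compact_norm_ball.
move=> rho rho0 rhoP; exists rho => // x y w xy.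
have [k xk] := translate_to_unit_cube x.
have xyk : `|x + intvec R k - (y + intvec R k)| < rho.
  by rewrite opprD addrACA subrr addr0.
have := rhoP _ _ _ xyk (tau (- k) w).
by rewrite !fstat -!tauD subrr tau0; apply; rewrite /= subr0.
Qed.

End moduli.

(** * Convexity of the Hamiltonian *)

Section convexity.
Context {R : realType} {d : nat}.
Implicit Types (h : 'rV[R]_d -> R) (p q v w : 'rV[R]_d).

Lemma derive_coord_sum h p v : differentiable h p ->
  'D_v h p = \sum_i v 0 i * 'D_(delta_mx 0 i) h p.
Proof.
move=> dh; rewrite deriveE// [v in LHS]row_sum_delta linear_sum.
by apply: eq_bigr => i _; rewrite linearZ /= deriveE.
Qed.

Lemma is_derive_line h p w (t : R) : (forall x, differentiable h x) ->
  is_derive t 1 (fun s : R => h (s *: w + p)) ('D_w h (t *: w + p)).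
Proof.
move=> dh; have /derivableP [der _] := @diff_derivable _ _ _ h (t *: w + p) w (dh _).
have E : (fun u : R => u^-1 *:
    (((fun s : R => h (s *: w + p)) \o shift t) (u *: (1 : R)) - h (t *: w + p))) =
  (fun u : R => u^-1 *: ((h \o shift (t *: w + p)) (u *: w) - h (t *: w + p))).
  apply/funext => u /=; congr (_ *: (h _ - _)).
  by rewrite /shift /= scalerDl [u *: 1]mulr1 addrA.
apply: DeriveDef; first by rewrite /derivable E.
by rewrite /derive E.
Qed.

(** Restrict [h] to the line from [p] to [q = w + p]. The second derivative along it is the Hessian
    form at [w], hence nonnegative, and the mean value theorem is applied twice: to [g] on [[0, 1]],
    then to [g'] on [[0, c]]. *)
Lemma tangent_le h : (forall x, differentiable h x) ->
  (forall v x, differentiable ('D_v h) x) -> (forall p, posdef (hessian h p)) ->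
  forall p q, h p + 'D_(q - p) h p <= h q.
Proof.
move=> dh ddh hpos p q.
have [w ->] : exists w, q = w + p by exists (q - p); rewrite subrK.
rewrite addrK.
have D2ge0 x : 0 <= 'D_w ('D_w h) x.
  have DwE : 'D_w h = \sum_(i < d) w 0 i *: 'D_(delta_mx 0 i) h.
    apply/funext => y; rewrite derive_coord_sum// fct_sumE.
    by apply: eq_bigr.
  have DiE i : 'D_(delta_mx 0 i) ('D_w h) x = \sum_j w 0 j * hessian h x i j.
    have der j : derivable ('D_(delta_mx 0 j) h) x (delta_mx 0 i).
      exact/diff_derivable/ddh.
    rewrite DwE derive_sum => [|j]; last exact: derivableZ.
    by apply: eq_bigr => j _; rewrite deriveZ// mxE.
  rewrite derive_coord_sum//.
  under eq_bigr do rewrite DiE.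
  (* Positive definiteness says nothing about the zero direction. *)
  have [w0|w0] := boolP (w == 0).
    by rewrite big1// => i _; rewrite (eqP w0) mxE mul0r.
  have := ltW (hpos x w w0); rewrite -mulmxA mxE => /le_trans; apply.
  rewrite le_eqVlt; apply/orP; left; apply/eqP; apply: eq_bigr => i _.
  by rewrite mxE; congr (_ * _); apply: eq_bigr => j _; rewrite [w^T _ _]mxE mulrC.
pose g (s : R) := h (s *: w + p); pose g' (s : R) : R := 'D_w h (s *: w + p).
have gd (s : R) : is_derive s (1 : R) g (g' s) by exact: is_derive_line.
have g'd (s : R) : is_derive s (1 : R) g' ('D_w ('D_w h) (s *: w + p)).
  exact: is_derive_line.
have cont (F dF : R -> R) (a b : R) : (forall s : R, is_derive s (1 : R) F (dF s)) ->
    {within `[a, b], continuous F}.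
  move=> Fd; apply: continuous_subspaceT => s.
  apply: differentiable_continuous; apply/derivable1_diffP.
  exact: (@ex_derive _ _ _ _ _ _ _ (Fd s)).
have [c] := MVT_segment ler01 (fun s _ => gd s) (cont _ _ 0 1 gd).
rewrite in_itv/= => /andP[c0 c1]; rewrite subr0 mulr1 /g scale1r scale0r add0r.
move=> gc.
have [e _] := MVT_segment c0 (fun s _ => g'd s) (cont _ _ 0 c g'd).
rewrite subr0 {2}/g' scale0r add0r => g'c.
have : 0 <= 'D_w ('D_w h) (e *: w + p) * c by rewrite mulr_ge0.
by lra.
Qed.

End convexity.

Section hamiltonian.
Context {R : realType} {d : nat}.
Variable H : 'rV[R]_d -> 'rV[R]_d -> R.
Hypothesis H_C2 : is_C2 (fun px : 'rV[R]_d * 'rV[R]_d => H px.1 px.2).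

Lemma C2_continuous : continuous (fun px : 'rV[R]_d * 'rV[R]_d => H px.1 px.2).
Proof. by move=> px; apply: differentiable_continuous; case: H_C2 => -[]. Qed.

Let differentiable_slice (G : 'rV[R]_d * 'rV[R]_d -> R) (x p : 'rV[R]_d) :
  (forall px, differentiable G px) -> differentiable (fun q => G (q, x)) p.
Proof.
move=> dG; apply: (@differentiable_comp _ _ _ _ (fun q => (q, x)) G) => //.
Qed.

(** The regularity of the slice [H(., x)] is inherited from the product space by differentiating in
    the directions [(v, 0)]. The tangent is written in coordinates so that it can later be averaged
    coordinate by coordinate. *)
Lemma hamiltonian_tangent (x : 'rV[R]_d) :
  (forall p, posdef (hessian (fun q => H q x) p)) ->
  forall p q, H p x + \sum_i (q - p) 0 i * 'D_(delta_mx 0 i) (fun r => H r x) p <= H q x.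
Proof.
move=> Hpos p q.
have [[dH _] ddH] := H_C2.
have dh y : differentiable (fun q => H q x) y.
  exact: (differentiable_slice x y dH).
rewrite -derive_coord_sum//; apply: tangent_le => // v y.
have -> : 'D_v (fun q => H q x) =
    (fun q => 'D_(v, 0) (fun px : 'rV[R]_d * 'rV[R]_d => H px.1 px.2) (q, x)).
  apply/funext => z; rewrite /derive /=.
  suff -> : (fun u : R => u^-1 *: (((fun q => H q x) \o shift z) (u *: v) - H z x))
    = (fun u : R => u^-1 *: (((fun px : 'rV[R]_d * 'rV[R]_d => H px.1 px.2)
        \o shift (z, x)) (u *: (v, 0)) - H z x)) by [].
  by apply/funext => u /=; rewrite scaler0 add0r.
have [ddv _] := ddH (v, 0).
exact: (differentiable_slice x y ddv).
Qed.

End hamiltonian.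

(** * Comparison by doubling of variables *)

(** If the slope [2a(x - y)] has norm at most [K], then [x] and [y] are within [K * eps], where
    [eps = 1 / (2a)]. First [eps] is fixed by [(K + 1) * eps = rho / 2], which determines [a]; then
    [r] is taken small in terms of [a], so that slopes perturbed by [(2 * a + 2) * r] stay within
    the modulus [rho]. *)
Lemma penalization_parameters (R : realType) (K rho M t : R) :
  0 <= K -> 0 < rho -> 0 <= M -> 0 < t -> exists eps a r : R,
    [/\ 0 < a, 2 * a * eps = 1, 0 < r & [/\ r <= 1, r <= eps, r + K * eps < rho,
      (2 * a + 2) * r < rho & M * r <= t]].
Proof.
move=> K0 rho0 M0 t0.
pose eps := rho / (2 * (K + 1)); pose a := (2 * eps)^-1.
have eps0 : 0 < eps by rewrite /eps divr_gt0//; lra.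
have epsE : eps * (2 * (K + 1)) = rho by rewrite /eps divfK// gt_eqF//; lra.
have a0 : 0 < a by rewrite /a invr_gt0; lra.
have aE : 2 * a * eps = 1.
  by rewrite mulrAC /a divff// gt_eqF//; lra.
pose s := rho / (2 * (2 * a + 2)); pose m := t / (M + 1).
have s0 : 0 < s by rewrite /s divr_gt0//; lra.
have sE : s * (2 * (2 * a + 2)) = rho by rewrite /s divfK// gt_eqF//; lra.
have m0 : 0 < m by rewrite /m divr_gt0//; lra.
have mE : m * (M + 1) = t by rewrite /m divfK// gt_eqF//; lra.
exists eps, a, (Num.min (Num.min 1 eps) (Num.min s m)).
set r := Num.min _ _.
have r0 : 0 < r by rewrite !lt_min ltr01 eps0 s0.
have [r1 re] : r <= 1 /\ r <= eps by apply/andP; rewrite -le_min ge_min lexx.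
have [rs rm] : r <= s /\ r <= m by apply/andP; rewrite -le_min ge_min lexx orbT.
have Mr : M * r <= M * m by rewrite ler_wpM2l.
have ar : a * r <= a * s by rewrite ler_wpM2l// ltW.
have Ke : 0 <= K * eps by rewrite mulr_ge0// ltW.
do 2! split => //; nra.
Qed.

Section comparison.
Context {R : realType} {d : nat}.
Variable H : 'rV[R]_d -> 'rV[R]_d -> R.
Implicit Types (x y c : 'rV[R]_d) (v chi f : 'rV[R]_d -> R).

(** The point is that the bound on the slope does not depend on [a]. With [n = |x - y|], one has
    [a n^2 <= L n + eta]. A slope [2 a n > 2L + 2] would force [n < eta <= eps], but also
    [n > 1 / a = 2 eps]. *)
Lemma penalized_distance v (L a eps eta : R) x y : 0 <= L -> 0 < a ->
  2 * a * eps = 1 -> eta <= eps ->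
  (forall x y, `|v x - v y| <= L * `|x - y|) ->
  a * sqnorm (x - y) <= `|v x - v y| + eta ->
  `|(2 * a) *: (x - y)| <= 2 * L + 2.
Proof.
move=> L0 a0 aE ee vL vxy; rewrite normrZ gtr0_norm; last by lra.
have eps0 : 0 < eps by rewrite -(pmulr_rgt0 _ a0); nra.
have := norm_le_sqnorm (x - y); have := vL x y.
have : 0 <= `|x - y| by [].
set n := `|x - y| => n0 h1 h2.
have h4 : a * n ^+ 2 <= L * n + eta.
  have : a * n ^+ 2 <= a * sqnorm (x - y) by rewrite ler_wpM2l// ltW.
  by lra.
rewrite leNgt; apply/negP => h5.
have en : 2 * eps < n.
  rewrite -(@ltr_pM2l _ (2 * a)); last by lra.
  have -> : 2 * a * (2 * eps) = 2 by rewrite mulrCA aE mulr1.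
  by nra.
by nra.
Qed.

Hypothesis H_continuous : continuous (fun px : 'rV[R]_d * 'rV[R]_d => H px.1 px.2).
Hypothesis H_periodic : forall p, Zd_periodic (H p).

Definition hamiltonian_modulus (K rho e : R) : Prop :=
  forall p q x y, `|p| <= K -> `|p - q| < rho ->
  `|x - y| < rho -> `|H q y - H p x| < e.

(** The slope at the perturbed minimum differs from [2a(c - y0)] by [(2 * a + 2) *: (y - y0)], and
    the contact point is within [r] of [y0]; the modulus of [H] absorbs both. The term [G] gathers
    what is not [H], so that the corrector and the discounted equations are treated alike. *)
Lemma supersolution_hamiltonian_ge (G : R -> 'rV[R]_d -> R) (u : 'rV[R]_d -> R)
    (K rho e a r eta : R) c y0 :
  hamiltonian_modulus K rho e -> 0 < a -> 0 < r -> r < rho -> (2 * a + 2) * r < rho ->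
  eta < r ^+ 2 -> `|(2 * a) *: (c - y0)| <= K ->
  continuous u -> viscosity_supersolution (fun s p x => G s x + H p x) u ->
  (forall y, u y0 + a * sqnorm (y0 - c) - eta <= u y + a * sqnorm (y - c)) ->
  exists2 y, `|y - y0| < r & - e <= G (u y) y + H ((2 * a) *: (c - y0)) y0.
Proof.
move=> Hmod a0 r0 rrho arho etar qK ucont usup umin.
have [y [yr _ Gy]] := supersolution_near_minimum r0 etar ucont usup umin.
exists y => //; move: Gy; set p := (_ - _) => Gy.
have : `|H p y - H ((2 * a) *: (c - y0)) y0| < e.
  apply: Hmod => //; last by rewrite distrC (lt_trans yr).
  have -> : (2 * a) *: (c - y0) - p = (2 * a + 2) *: (y - y0).
    by apply/rowP => i; rewrite !mxE; ring.
  rewrite normrZ gtr0_norm; last by lra.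
  by rewrite (le_lt_trans _ arho)// ler_wpM2l ?(ltW yr)//; lra.
by rewrite ltr_norml => /andP[_]; lra.
Qed.

(** Here [H] is moved to the centre [c], at distance at most [K * eps] from [y0]. In the doubling,
    the subsolution and supersolution inequalities then involve the same slope and the same
    point. *)
Lemma subsolution_hamiltonian_le (G : R -> 'rV[R]_d -> R) (u : 'rV[R]_d -> R)
    (K rho e a eps r eta : R) c y0 :
  hamiltonian_modulus K rho e -> 0 < a -> 2 * a * eps = 1 -> 0 < r -> r + K * eps < rho ->
  (2 * a + 2) * r < rho ->
  eta < r ^+ 2 -> `|(2 * a) *: (y0 - c)| <= K ->
  continuous u -> viscosity_subsolution (fun s p x => G s x + H p x) u ->
  (forall y, u y - a * sqnorm (y - c) <= u y0 - a * sqnorm (y0 - c) + eta) ->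
  exists y, [/\ `|y - y0| < r, `|y - c| < rho &
    G (u y) y + H ((2 * a) *: (y0 - c)) c <= e].
Proof.
move=> Hmod a0 aE r0 rrho arho etar qK ucont usub umax.
have [y [yr _ Gy]] := subsolution_near_maximum r0 etar ucont usub umax.
have yc : `|y - c| < rho.
  rewrite (le_lt_trans (ler_distD y0 _ _))// (lt_trans _ rrho)// ltr_leD//.
  move: qK; rewrite normrZ gtr0_norm; last by lra.
  have eps0 : 0 < eps by rewrite -(pmulr_rgt0 _ a0); nra.
  move=> /(ler_wpM2l (ltW eps0)); rewrite mulrA [eps * _]mulrC aE mul1r.
  by rewrite mulrC.
exists y; split => //; move: Gy; set p := (_ *: _ + _) => Gy.
have : `|H p y - H ((2 * a) *: (y0 - c)) c| < e.
  apply: Hmod => //; last by rewrite distrC.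
  have -> : (2 * a) *: (y0 - c) - p = (- (2 * a + 2)) *: (y - y0).
    by apply/rowP => i; rewrite !mxE; ring.
  rewrite normrZ normrN gtr0_norm; last by lra.
  by rewrite (le_lt_trans _ arho)// ler_wpM2l ?(ltW yr)//; lra.
by rewrite ltr_norml => /andP[+ _]; lra.
Qed.

Lemma discounted_lower_bound chi v f (Hbar C L B delta : R) :
  continuous chi -> viscosity_subsolution (fun _ p x => H p x - Hbar) chi ->
  (forall x, `|chi x| <= C) ->
  0 < delta -> 0 <= L -> (forall x y, `|v x - v y| <= L * `|x - y|) ->
  (forall x, `|v x| <= B) -> continuous v -> (forall x, 0 <= f x) ->
  viscosity_supersolution (fun r p x => delta * r + H p x - f x) v ->
  forall x, - (delta * v x) <= Hbar + 2 * delta * C.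
Proof.
move=> chi_cont chi_sub chiC delta0 L0 vL vB v_cont f0 v_sup x0.
apply/ler_addgt0Pr => e e0.
have e40 : 0 < e / 4 by rewrite divr_gt0.
have e20 : 0 < e / 2 by rewrite divr_gt0.
have [rho rho0 Hmod] :=
  hamiltonian_uniform_modulus H_continuous H_periodic (2 * L + 2) e40.
have [||eps [a [r [a0 aE r0 [r1 re rrho arho Mr]]]]] :=
  @penalization_parameters _ (2 * L + 2) rho (delta * (L + 1)) (e / 2) _ rho0 _ e20.
- by lra.
- by rewrite mulr_ge0 ?(ltW delta0)//; lra.
pose J (z : 'rV[R]_d * 'rV[R]_d) := chi z.1 - v z.2 - a * sqnorm (z.1 - z.2).
have J_sup : has_sup (range J).
  split; first by exists (J (0, 0)); exists (0, 0).
  exists (C + B) => _ [[x y] _ <-]; rewrite /J /=.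
  have := chiC x; have := vB y; rewrite !ler_norml => /andP[? ?] /andP[? ?].
  have : 0 <= a * sqnorm (x - y) by rewrite mulr_ge0 ?sqnorm_ge0 ?ltW.
  by lra.
(* Smaller than [r ^+ 2], as the perturbation requires, and at most [r] because [r <= 1]. *)
pose eta := r ^+ 2 / 2.
have eta0 : 0 < eta by rewrite /eta divr_gt0// exprn_gt0.
have etar : eta < r ^+ 2 by move: eta0; rewrite /eta; lra.
have eta_r : eta <= r by rewrite /eta; nra.
have [_ [[x y] _ <-]] := sup_adherent eta0 J_sup.
set S := sup _ => xy_max.
have {}xy_max z : J z <= J (x, y) + eta.
  have : J z <= S by apply: sup_upper_bound => //; exists z.
  by lra.
have qK : `|(2 * a) *: (x - y)| <= 2 * L + 2.
  apply: (@penalized_distance v L a eps eta x y L0 a0 aE (le_trans eta_r re) vL).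
  have := xy_max (x, x); rewrite /J /= subrr sqnorm0.
  by have := ler_norm (v x - v y); lra.
have rrho' : r < rho.
  have : 0 <= (2 * L + 2) * eps.
    by rewrite mulr_ge0//; [lra|rewrite (le_trans _ re)// ltW].
  by lra.
have [x' [_ _ Hx]] : exists x', [/\ `|x' - x| < r, `|x' - y| < rho &
    (fun _ _ => - Hbar) (chi x') x' + H ((2 * a) *: (x - y)) y <= e / 4].
  apply: (@subsolution_hamiltonian_le (fun _ _ => - Hbar) _ _ _ _ _ _ _ _ _ _
    Hmod a0 aE r0 rrho arho etar qK chi_cont).
    by move=> phi z phi1 zmax; have := chi_sub phi z phi1 zmax; rewrite addrC.
  by move=> z; have := xy_max (z, y); rewrite /J /=; lra.
have [y' y'r Hy] : exists2 y', `|y' - y| < r &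
    - (e / 4) <= (fun s z => delta * s - f z) (v y') y' + H ((2 * a) *: (x - y)) y.
  apply: (@supersolution_hamiltonian_ge (fun s z => delta * s - f z) _ _ _ _ _ _ _ _ _
    Hmod a0 r0 rrho' arho etar qK v_cont).
    by move=> phi z phi1 zmin; have := v_sup phi z phi1 zmin; rewrite addrAC.
  move=> z; have := xy_max (x, z).
  by rewrite /J /= (sqnormB y x) (sqnormB z x); lra.
(* Comparison with the diagonal point [(x0, x0)] bounds [v y - v x0] by the oscillation [2 * C] of
   [chi] plus [eta]; this is the source of [2 * delta * C]. *)
have := xy_max (x0, x0); rewrite /J /= subrr sqnorm0.
have := chiC x; have := chiC x0; rewrite !ler_norml => /andP[? ?] /andP[? ?].
have := sqnorm_ge0 (x - y); have := f0 y'.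
have vy : v y' - v y <= L * r.
  rewrite (le_trans (ler_norm _))// (le_trans (vL _ _))//.
  by rewrite ler_wpM2l// ltW.
move=> fy' sq0 Jx0.
have : 0 <= a * sqnorm (x - y) by rewrite mulr_ge0// ltW.
move=> asq.
have : delta * (v y' - v x0) <= delta * (L * r + r + 2 * C).
  by rewrite ler_pM2l//; lra.
by lra.
Qed.

End comparison.

(** * Random points *)

Section selection.
Context {R : realType} {disp : measure_display} {Omega : measurableType disp}.

Lemma measurable_fun_index (k : Omega -> nat) (h : nat -> Omega -> R) :
  measurable_fun setT k -> (forall i, measurable_fun setT (h i)) ->
  measurable_fun setT (fun w => h (k w) w).
Proof.
move=> mk mh _ Y mY; rewrite setTI.
have -> : (fun w => h (k w) w) @^-1` Y =
    \bigcup_i (k @^-1` [set i] `&` (h i) @^-1` Y).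
  apply/seteqP; split=> w /=; first by move=> hY; exists (k w).
  by case=> i _ [/= <-].
apply: bigcupT_measurable => i; apply: measurableI.
  by rewrite -[X in measurable X]setTI; exact: mk.
by rewrite -[X in measurable X]setTI; exact: mh.
Qed.

(** The index [n.+1] replaces the previous winner exactly where it strictly beats it, which is a
    measurable event. *)
Lemma measurable_argmax (h : nat -> Omega -> R) (n : nat) :
  (forall i, measurable_fun setT (h i)) ->
  exists k : Omega -> nat, [/\ measurable_fun setT k, forall w, (k w <= n)%N &
    forall w i, (i <= n)%N -> h i w <= h (k w) w].
Proof.
move=> mh; elim: n => [|n [k [mk kn kmax]]].
  exists (fun=> 0); split => //.
  by move=> w i; rewrite leqn0 => /eqP ->.
exists (fun w => if h (k w) w < h n.+1 w then n.+1 else k w); split.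
- apply: measurable_fun_ifT => //.
  by apply: measurable_fun_ltr => //; exact: measurable_fun_index.
- by move=> w; case: ifP => // _; rewrite leqW.
- move=> w i; rewrite leq_eqVlt ltnS; case: ltP => hk /predU1P[->//|iin] //.
    by rewrite (le_trans (kmax w i iin))// ltW.
  exact: kmax.
Qed.

End selection.

(** * Means of random points over an event of full probability *)

Section averaging.
Context {R : realType} {d : nat} {disp : measure_display}.
Context {Omega : measurableType disp} (P : probability Omega R).
Variables (A : set Omega).
Hypotheses (mA : measurable A) (PA : P A = 1%E).

(** A bounded random point with countably many values, read off a measurable index. Measurability of
    [h (X w) w] then follows from that of each [h x], without joint measurability of [h]. *)
Definition selector (X : Omega -> 'rV[R]_d) : Prop :=
  exists (k : Omega -> nat) (g : nat -> 'rV[R]_d) (M : R),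
    [/\ measurable_fun setT k, X = g \o k & forall w, `|X w| <= M].

Local Notation ig F := (P.-integrable A (EFin \o F)).

Lemma integrable_bounded_on (F : Omega -> R) (M : R) :
  measurable_fun setT F -> (forall w, A w -> `|F w| <= M) -> ig F.
Proof.
move=> mF FM; apply: measurable_bounded_integrable => //.
- by apply: (le_lt_trans (probability_le1 P mA)); exact: ltry.
- exact: measurable_funTS.
- exists M; split; first exact: num_real.
  by move=> N MN w Aw /=; rewrite (le_trans (FM _ Aw))// ltW.
Qed.

Lemma integrable_add F G : ig F -> ig G -> ig (fun w => F w + G w).
Proof. by move=> iF iG; have := integrableD mA iF iG. Qed.

Lemma integrable_scale (c : R) F : ig F -> ig (fun w => c * F w).
Proof. by move=> iF; have := integrableZl mA c iF. Qed.

Lemma integrable_const (c : R) : ig (fun=> c).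
Proof. exact: finite_measure_integrable_cst. Qed.

Lemma Rintegral_const (c : R) : \int[P]_(w in A) c = c.
Proof.
transitivity (c * fine (P A)); first exact: Rintegral_cst.
by rewrite PA mulr1.
Qed.

Lemma integrable_fsum n (F : 'I_n -> Omega -> R) : (forall i, ig (F i)) ->
  ig (fun w => \sum_i F i w).
Proof.
move=> iF; have := @integrable_sum _ _ _ P A mA _ (index_enum 'I_n) xpredT
  (fun i => EFin \o F i) (fun i _ => iF i).
by apply: eq_integrable => // w _ /=; rewrite sumEFin.
Qed.

Lemma Rintegral_fsum n (F : 'I_n -> Omega -> R) : (forall i, ig (F i)) ->
  \int[P]_(w in A) (\sum_i F i w) = \sum_i \int[P]_(w in A) F i w.
Proof.
elim: n F => [|n IH] F iF.
  under eq_Rintegral do rewrite big_ord0.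
  by rewrite big_ord0 Rintegral_const.
rewrite big_ord_recl -IH//.
under eq_Rintegral do rewrite big_ord_recl.
by rewrite RintegralD//; exact: (@integrable_fsum n (fun i => F (lift ord0 i))).
Qed.

Definition mean (X : Omega -> 'rV[R]_d) : 'rV[R]_d :=
  \row_i \int[P]_(w in A) X w 0 i.

Lemma selector_measurable X (h : 'rV[R]_d -> Omega -> R) : selector X ->
  (forall x, measurable_fun setT (h x)) -> measurable_fun setT (fun w => h (X w) w).
Proof.
move=> [k [g [_ [mk -> _]]]] mh.
exact: (@measurable_fun_index _ _ _ k (fun i => h (g i))).
Qed.

Lemma selector_coord_integrable X i : selector X -> ig (fun w => X w 0 i).
Proof.
move=> sX; have [k [g [M [_ _ XM]]]] := sX.
apply: (@integrable_bounded_on _ M).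
  exact: (@selector_measurable X (fun x _ => x 0 i)).
by move=> w _; rewrite (le_trans (normr_coord_le _ _)).
Qed.

Lemma affine_integrable X (c : R) (b : 'I_d -> R) : selector X ->
  ig (fun w => c + \sum_i b i * X w 0 i).
Proof.
move=> sX; apply: integrable_add; first exact: integrable_const.
by apply: integrable_fsum => i; exact/integrable_scale/selector_coord_integrable.
Qed.

Lemma Rintegral_affine X (c : R) (b : 'I_d -> R) : selector X ->
  \int[P]_(w in A) (c + \sum_i b i * X w 0 i) = c + \sum_i b i * mean X 0 i.
Proof.
move=> sX; have iX i := selector_coord_integrable i sX.
rewrite RintegralD//; last 2 first.
- exact: integrable_const.
- by apply: integrable_fsum => i; exact: integrable_scale.
rewrite Rintegral_const Rintegral_fsum => [|i]; last exact: integrable_scale.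
congr (_ + _); apply: eq_bigr => i _; rewrite mxE RintegralZl//; exact: iX.
Qed.

(** For the sup norm it suffices to integrate two-sided bounds on each coordinate. *)
Lemma norm_mean_le X y (K : R) : 0 <= K -> selector X ->
  (forall w, A w -> `|X w - y| <= K) -> `|mean X - y| <= K.
Proof.
move=> K0 sX XK; apply: norm_row_leP => // i; rewrite !mxE.
have iX := selector_coord_integrable i sX.
have Xi w : A w -> y 0 i - K <= X w 0 i <= y 0 i + K.
  move=> Aw; have := le_trans (normr_coord_le (X w - y) i) (XK w Aw).
  by rewrite !mxE ler_norml => /andP[? ?]; apply/andP; split; lra.
have h1 : y 0 i - K <= \int[P]_(w in A) X w 0 i.
  rewrite -[leLHS]Rintegral_const; apply: le_Rintegral => //.
  - exact: integrable_const.
  - by move=> w /Xi /andP[].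
have h2 : \int[P]_(w in A) X w 0 i <= y 0 i + K.
  rewrite -[leRHS]Rintegral_const; apply: le_Rintegral => //.
  - exact: integrable_const.
  - by move=> w /Xi /andP[].
by rewrite ler_norml; lra.
Qed.

End averaging.

Section near_maximisers.
Context {R : realType} {d : nat} {disp : measure_display}.
Context {Omega : measurableType disp}.
Variables (A : set Omega).
Implicit Types (x y z : 'rV[R]_d) (v : 'rV[R]_d -> Omega -> R).

Lemma cst_selector x : selector (fun=> x : 'rV[R]_d) (Omega := Omega).
Proof. by exists (fun=> 0), (fun=> x), `|x|. Qed.

(** At distance more than [L / a] from [y], the penalty outweighs what [v] can gain, and [y] itself
    does at least as well. Within that distance a finite deterministic net suffices; only the index
    of the best point of the net depends on [w]. *)
Lemma near_maximal_selector v y (a eps L eta : R) :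
  0 <= L -> 0 < a -> 2 * a * eps = 1 -> 0 < eta ->
  (forall x, measurable_fun setT (v x)) ->
  (forall w, A w -> forall x z, `|v x w - v z w| <= L * `|x - z|) ->
  exists2 X, selector X & forall w, A w -> forall x,
    v x w - a * sqnorm (x - y) <= v (X w) w - a * sqnorm (X w - y) + eta.
Proof.
move=> L0 a0 aE eta0 mv vL.
have eps0 : 0 < eps by rewrite -(pmulr_rgt0 _ a0); nra.
(* This is [L / a], since [2 * a * eps = 1]. *)
pose rho := 2 * L * eps.
have rho0 : 0 <= rho by rewrite /rho !mulr_ge0// ltW.
(* Lipschitz bound for the penalised function between a point of the ball and a point of the net,
   the latter within [rho + 1] of [y] as [h <= 1]. *)
pose c := L + a * (d%:R * (2 * rho + 1)).
have c0 : 0 <= c.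
  by rewrite addr_ge0// mulr_ge0 ?(ltW a0)// mulr_ge0//; lra.
pose h := Num.min 1 (eta / (c + 1)).
have h0 : 0 < h by rewrite lt_min ltr01 divr_gt0//; lra.
have h1 : h <= 1 by rewrite /h ge_min lexx.
have ch : c * h <= eta.
  have : (c + 1) * h <= eta.
    by rewrite mulrC -ler_pdivlMr; [rewrite /h ge_min lexx orbT|lra].
  by lra.
have [n [g gnet]] := finite_net y rho h0.
(* Index 0 is the centre [y]; the net is shifted to the indices from 1 to [n.+1]. *)
pose gg i := if i is j.+1 then g (inord j) else y.
have [k [mk _ kmax]] := @measurable_argmax _ _ _
  (fun i w => v (gg i) w - a * sqnorm (gg i - y)) n.+1
  (fun i => measurable_funB (mv (gg i)) (measurable_cst _)).
exists (gg \o k).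
  exists k, gg, (`|y| + \sum_j `|g j|); split => // w /=.
  case: (k w) => [|j] /=; first by rewrite lerDl sumr_ge0.
  by rewrite (bigD1 (inord j))//= addrCA lerDl addr_ge0// sumr_ge0.
move=> w Aw x /=.
have [xrho|xrho] := leP `|x - y| rho.
  have [i xi] := gnet x xrho.
  have := kmax w i.+1; rewrite ltnS -ltnS ltn_ord => /(_ isT).
  have -> : gg i.+1 = g i by rewrite /gg inord_val.
  move=> kw.
  have v_i := le_trans (ler_norm _) (vL w Aw x (g i)).
  have := le_trans (ler_norm _) (sqnorm_sub_le (g i - y) (x - y)).
  rewrite opprB addrA subrK distrC => sq_i.
  have gy : `|g i - y| <= rho + 1.
    rewrite (le_trans (ler_distD x _ _))// distrC; lra.
  have : `|x - g i| * (`|g i - y| + `|x - y|) <= h * (2 * rho + 1).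
    by rewrite ler_pM//; lra.
  move=> /(ler_wpM2l (ler0n R d)) /(le_trans sq_i) /(ler_wpM2l (ltW a0)).
  have : L * `|x - g i| <= L * h by rewrite ler_wpM2l// ltW.
  by move: ch; rewrite /c; lra.
have := kmax w 0; rewrite /= subrr sqnorm0 mulr0 subr0 => /(_ isT).
have v_y := le_trans (ler_norm _) (vL w Aw x y).
have : a * `|x - y| ^+ 2 <= a * sqnorm (x - y).
  by rewrite ler_wpM2l ?norm_le_sqnorm// ltW.
have : L * `|x - y| <= a * `|x - y| ^+ 2.
  rewrite expr2 mulrA ler_wpM2r//.
  have -> : L = a * rho.
    rewrite /rho; transitivity (L * (2 * a * eps)); last by ring.
    by rewrite aE mulr1.
  by rewrite ler_wpM2l ?ltW.
by move: v_y; set t := _ - y; lra.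
Qed.

End near_maximisers.

(** * Comparison in mean with the corrector *)

Section averaged_comparison.
Context {R : realType} {d : nat} {disp : measure_display}.
Context {Omega : measurableType disp} (P : probability Omega R).
Variables (A : set Omega).
Hypotheses (mA : measurable A) (PA : P A = 1%E).
Variable H : 'rV[R]_d -> 'rV[R]_d -> R.
Hypothesis H_C2 : is_C2 (fun px : 'rV[R]_d * 'rV[R]_d => H px.1 px.2).
Hypothesis H_periodic : forall p, Zd_periodic (H p).
Hypothesis H_convex : forall p x, posdef (hessian (fun q => H q x) p).
Variables (v f : 'rV[R]_d -> Omega -> R) (chi : 'rV[R]_d -> R).
Variables (Hbar C L B M delta : R).
Hypothesis chi_cont : continuous chi.
Hypothesis chi_sup : viscosity_supersolution (fun _ p x => H p x - Hbar) chi.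
Hypothesis chiC : forall x, `|chi x| <= C.
Hypotheses (delta0 : 0 < delta) (L0 : 0 <= L).
Hypothesis mv : forall x, measurable_fun setT (v x).
Hypothesis vL : forall w, A w -> forall x z, `|v x w - v z w| <= L * `|x - z|.
Hypothesis vB : forall w, A w -> forall x, `|v x w| <= B.
Hypothesis v_cont : forall w, A w -> continuous (v^~ w).
Hypothesis v_sub : forall w, A w ->
  viscosity_subsolution (fun r p x => delta * r + H p x - f x w) (v^~ w).
Hypothesis f_mod : forall e : R, 0 < e -> exists2 rho : R, 0 < rho &
  forall x y w, `|x - y| < rho -> `|f y w - f x w| < e.
Hypothesis f_int : forall x, P.-integrable A (EFin \o f x).
Hypothesis f_mean : forall x, \int[P]_(w in A) f x w <= M.

Let gain (a : R) (X : Omega -> 'rV[R]_d) y w := v (X w) w - a * sqnorm (X w - y).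

Let gain_integrable a X y : 0 <= a -> selector X ->
  P.-integrable A (EFin \o gain a X y).
Proof.
move=> a0 sX; have [k [g [N [_ _ XN]]]] := sX.
apply: (@integrable_bounded_on _ _ _ P A mA (gain a X y)
  (B + a * (d%:R * ((N + `|y|) * (N + `|y|))))).
  apply: (@selector_measurable _ _ _ _ X (fun x w => v x w - a * sqnorm (x - y)) sX).
  by move=> x; apply: measurable_funB => //; exact: measurable_cst.
move=> w Aw; rewrite (le_trans (ler_normB _ _))// lerD ?vB//.
rewrite normrM ger0_norm// ler_wpM2l// -[sqnorm _]subr0 -(@sqnorm0 R d).
rewrite (le_trans (sqnorm_sub_le _ _))// subr0 normr0 addr0 ler_wpM2l//.
have XyN : `|X w - y| <= N + `|y| by rewrite (le_trans (ler_normB _ _))// lerD2r.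
by rewrite ler_pM.
Qed.

Let value_integrable X : selector X -> P.-integrable A (EFin \o (fun w => v (X w) w)).
Proof.
move=> sX; apply: (@integrable_bounded_on _ _ _ P A mA (fun w => v (X w) w) B).
  exact: selector_measurable.
by move=> w Aw; exact: vB.
Qed.

Let const_integrable (c : R) : P.-integrable A (EFin \o (fun=> c)).
Proof. exact: integrable_const. Qed.

(** The constants [L] and [B] affect only the choice of [a] and [r] and the finiteness of a
    supremum. They are absent from the bound and may therefore depend on [delta]. *)
Lemma averaged_upper_bound x0 :
  delta * \int[P]_(w in A) v x0 w <= M - Hbar + 2 * delta * C.
Proof.
apply/ler_addgt0Pr => e e0; have L_ge0 := L0.
have e80 : 0 < e / 8 by rewrite divr_gt0.
have e20 : 0 < e / 2 by rewrite divr_gt0.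
have [rhoH rhoH0 Hmod] := hamiltonian_uniform_modulus (C2_continuous H_C2)
  H_periodic (2 * L + 2) e80.
have [rhof rhof0 fmod] := f_mod e80.
pose rho := Num.min rhoH rhof.
have rho0 : 0 < rho by rewrite lt_min rhoH0.
have [rhoHle rhofle] : rho <= rhoH /\ rho <= rhof by rewrite /rho !ge_min !lexx orbT.
have K0 : 0 <= 2 * L + 2 by lra.
have [||eps [a [r [a0 aE r0 [r1 re rrho arho Mr]]]]] :=
  @penalization_parameters _ (2 * L + 2) rho (delta * (L + 1)) (e / 2) _ rho0 _ e20.
- by [].
- by rewrite mulr_ge0 ?(ltW delta0)//; lra.
have rrho' : r < rho.
  have : 0 <= (2 * L + 2) * eps.
    by rewrite mulr_ge0// (le_trans _ re)// ltW.
  by lra.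
have {}Hmod p q x y : `|p| <= 2 * L + 2 -> `|p - q| < rho -> `|x - y| < rho ->
    `|H q y - H p x| < e / 8.
  by move=> pK pq xy; apply: Hmod => //; exact: lt_le_trans rhoHle.
pose eta := r ^+ 2 / 2.
have eta0 : 0 < eta by rewrite /eta divr_gt0// exprn_gt0.
(* One half of [eta] is spent on the supremum over [(y, X)], the other on passing from a maximiser
   in mean to a pointwise one. *)
have eta20 : 0 < eta / 2 by rewrite divr_gt0.
have etar : eta < r ^+ 2 by move: eta0; rewrite /eta; lra.
have eta_r : eta <= r by rewrite /eta; nra.
(* The supremum over X is the mean of the sup-convolution of v(., w), without
   any measurability issue. *)
pose J y X := \int[P]_(w in A) gain a X y w - chi y.
pose S := [set j | exists y X, selector X /\ j = J y X].
have S_sup : has_sup S.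
  split; first by exists (J 0 (fun=> 0)), 0, (fun=> 0); split => //; exact: cst_selector.
  exists (B + C) => _ [y [X [sX ->]]].
  have : \int[P]_(w in A) gain a X y w <= B.
    rewrite -[leRHS](Rintegral_const mA PA); apply: le_Rintegral => //.
      by apply: gain_integrable => //; exact: ltW.
    move=> w Aw; have := ler_norm (v (X w) w); have := vB Aw (X w).
    have : 0 <= a * sqnorm (X w - y) by rewrite mulr_ge0 ?sqnorm_ge0 ?ltW.
    by rewrite /gain; lra.
  by have := chiC y; rewrite ler_norml /J => /andP[? ?]; lra.
have [_ [y [X0 [sX0 ->]]]] := sup_adherent eta20 S_sup.
set s := sup _ => JX0.
(* [X0] is nearly optimal only in mean. It is replaced by [X], nearly optimal for each [w] in [A],
   so that the equation of [v] can be used for each such [w]. *)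
have [X sX X_max] :=
  near_maximal_selector y L0 a0 aE eta20 mv vL.
have JX z Y : selector Y -> J z Y <= J y X + eta.
  move=> sY; have : J z Y <= s by apply: sup_upper_bound => //; exists z, Y.
  have : \int[P]_(w in A) gain a X0 y w <= \int[P]_(w in A) (gain a X y w + eta / 2).
    apply: le_Rintegral => //.
    - by apply: gain_integrable => //; exact: ltW.
    - by apply: integrable_add => //; apply: gain_integrable => //; exact: ltW.
    - by move=> w Aw; exact: X_max.
  rewrite RintegralD//; last by apply: gain_integrable => //; exact: ltW.
  by rewrite (Rintegral_const mA PA); move: JX0; rewrite /J; lra.
pose Xbar := mean P A X.
have qK w : A w -> `|(2 * a) *: (X w - y)| <= 2 * L + 2.
  move=> Aw; apply: (@penalized_distance _ _ (v^~ w) L a eps (eta / 2)) => //.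
    by lra.
    exact: vL.
  have := X_max w Aw y; rewrite subrr sqnorm0.
  by have := ler_norm (v (X w) w - v y w); lra.
have a20 : 0 < 2 * a by lra.
have qbarK : `|(2 * a) *: (Xbar - y)| <= 2 * L + 2.
  rewrite normrZ gtr0_norm// mulrC -ler_pdivlMr//.
  apply: (norm_mean_le mA PA) => //; first by rewrite divr_ge0// ltW.
  by move=> w Aw; rewrite ler_pdivlMr// mulrC -[2 * a](gtr0_norm a20) -normrZ qK.
(* Of [e / 4], one half comes from the modulus of [H] and one half from that of [f];
   [delta * (L * r)] pays for moving from the contact point back to [X w]. *)
have pointwise w : A w ->
    delta * v (X w) w + H ((2 * a) *: (X w - y)) y <= f y w + e / 4 + delta * (L * r).
  move=> Aw.
  have [x [xr xrho Hx]] := @subsolution_hamiltonian_le _ _ H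
    (fun s z => delta * s - f z w) (v^~ w) _ _ _ _ _ _ eta y (X w)
    Hmod a0 aE r0 rrho arho etar (qK w Aw) (v_cont Aw)
    (fun phi z phi1 zmax => ltac:(by have := v_sub Aw phi1 zmax; rewrite addrAC))
    (fun z => ltac:(by have := X_max w Aw z; lra)).
  have := fmod x y w (lt_le_trans xrho rhofle).
  rewrite ltr_norml => /andP[fxy _].
  have := vL Aw (X w) x; rewrite (distrC (X w)) => vXx.
  have vx : v (X w) w - v x w <= L * r.
    rewrite (le_trans (ler_norm _))// (le_trans vXx)// ler_wpM2l// ltW//.
  have : delta * (v (X w) w - v x w) <= delta * (L * r) by rewrite ler_pM2l.
  by lra.
pose G i := 'D_(delta_mx 0 i) (fun q => H q y) ((2 * a) *: (Xbar - y)).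
(* Jensen's inequality, through the tangent of H(., y) at the mean slope: only
   affine functions of X have to be integrated. *)
have averaged : delta * \int[P]_(w in A) v (X w) w + H ((2 * a) *: (Xbar - y)) y <=
    M + e / 4 + delta * (L * r).
  have -> : delta * \int[P]_(w in A) v (X w) w + H ((2 * a) *: (Xbar - y)) y =
      \int[P]_(w in A) (delta * v (X w) w + (H ((2 * a) *: (Xbar - y)) y -
        \sum_i 2 * a * G i * Xbar 0 i + \sum_i (2 * a * G i) * X w 0 i)).
    rewrite RintegralD//; first last.
    - exact: affine_integrable.
    - by apply: integrable_scale => //; exact: value_integrable.
    rewrite RintegralZl//; last exact: value_integrable.
    by rewrite Rintegral_affine// subrK.
  have : \int[P]_(w in A) (f y w + (e / 4 + delta * (L * r))) <=
      M + (e / 4 + delta * (L * r)).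
    by rewrite RintegralD// (Rintegral_const mA PA) lerD2r.
  rewrite addrA; apply: le_trans; apply: le_Rintegral => //.
  - apply: integrable_add => //; last exact: affine_integrable.
    by apply: integrable_scale => //; exact: value_integrable.
  - exact: integrable_add.
  move=> w Aw; have := pointwise w Aw.
  have := hamiltonian_tangent H_C2 (fun p => H_convex p y)
    ((2 * a) *: (Xbar - y)) ((2 * a) *: (X w - y)).
  have -> : \sum_i ((2 * a) *: (X w - y) - (2 * a) *: (Xbar - y)) 0 i * G i =
      \sum_i (2 * a * G i) * X w 0 i - \sum_i 2 * a * G i * Xbar 0 i.
    by rewrite -sumrB; apply: eq_bigr => i _; rewrite !mxE; ring.
  by rewrite -/G; lra.
have Hbar_le : Hbar <= H ((2 * a) *: (Xbar - y)) y + e / 8.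
  (* The mean of |X - z|^2 is |Xbar - z|^2 up to a constant independent of z. *)
  have chi_min z : chi y + a * sqnorm (y - Xbar) - eta <=
      chi z + a * sqnorm (z - Xbar).
    have := JX z X sX; rewrite /J.
    have E : \int[P]_(w in A) gain a X z w = \int[P]_(w in A) gain a X y w +
        a * (sqnorm (y - Xbar) - sqnorm (z - Xbar)).
      have -> : \int[P]_(w in A) gain a X z w = \int[P]_(w in A) (gain a X y w +
          (a * \sum_i (y 0 i ^+ 2 - z 0 i ^+ 2) +
           \sum_i (2 * a * (z 0 i - y 0 i)) * X w 0 i)).
        apply: eq_Rintegral => w _; rewrite /gain -addrA; congr (_ + _).
        rewrite /sqnorm !mulr_sumr -!sumrN -!big_split /=.
        by apply: eq_bigr => i _; rewrite !mxE; ring.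
      rewrite RintegralD//; first last.
      - exact: affine_integrable.
      - by apply: gain_integrable => //; exact: ltW.
      rewrite Rintegral_affine//; congr (_ + _).
      rewrite /sqnorm -sumrB !mulr_sumr -big_split /=.
      by apply: eq_bigr => i _; rewrite !mxE; ring.
    by rewrite E; lra.
  have [y' _] := @supersolution_hamiltonian_ge _ _ H (fun _ _ => - Hbar) chi
    _ _ _ _ _ eta Xbar y Hmod a0 r0 rrho' arho etar qbarK chi_cont
    (fun phi z phi1 zmin => ltac:(by have := chi_sup phi1 zmin; rewrite addrC))
    chi_min.
  by lra.
(* The competitor is the deterministic point [x0] paired with itself, for which the penalty
   vanishes. *)
have := JX x0 (fun=> x0) (cst_selector x0); rewrite /J.
have -> : \int[P]_(w in A) gain a (fun=> x0) x0 w = \int[P]_(w in A) v x0 w.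
  by apply: eq_Rintegral => w _; rewrite /gain subrr sqnorm0 mulr0 subr0.
have : \int[P]_(w in A) gain a X y w <= \int[P]_(w in A) v (X w) w.
  apply: le_Rintegral => //.
  - by apply: gain_integrable => //; exact: ltW.
  - exact: value_integrable.
  by move=> w _; rewrite /gain gerBl mulr_ge0 ?sqnorm_ge0 ?ltW.
have := chiC y; have := chiC x0; rewrite !ler_norml => /andP[? ?] /andP[? ?].
move=> h1 h2.
have : delta * \int[P]_(w in A) v x0 w <=
    delta * (\int[P]_(w in A) v (X w) w + 2 * C + r) by rewrite ler_pM2l//; lra.
by lra.
Qed.

End averaged_comparison.

(** * Ergodicity *)

Lemma limn_einf_le (R : realType) (u : (\bar R)^nat) (c : \bar R) :
  (forall n, (u n <= c)%E) -> (limn_einf u <= c)%E.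
Proof.
move=> uc; rewrite limn_einf_lim; apply: lime_le; first exact: is_cvg_einfs.
apply: nearW => n; rewrite (le_trans _ (uc n))//.
by apply: ereal_inf_lbound; exists n => /=.
Qed.

Lemma rational_vector_near (R : realType) (d : nat) (x : 'rV[R]_d) (e : R) :
  0 < e -> exists q : 'rV[rat]_d, `|x - map_mx ratr q| < e.
Proof.
move=> e0.
have near_coord i : exists r : rat, `|x 0 i - ratr r| < e.
  have [|r] := @rat_in_itvoo R (x 0 i - e) (x 0 i + e); first by lra.
  rewrite in_itv/= => /andP[r1 r2]; exists r.
  by rewrite ltr_norml; apply/andP; split; lra.
have [r rP] := choice near_coord.
exists (\row_i r i); apply: norm_rowP => // i.
by rewrite !mxE.
Qed.

Section ergodic_bounds.
Context {R : realType} {d : nat} {disp : measure_display}.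
Context {Omega : measurableType disp} (P : probability Omega R).
Variable tau : 'rV[int]_d -> Omega -> Omega.
Hypothesis tau0 : forall w, tau 0 w = w.
Hypothesis tauD : forall (k l : 'rV[int]_d) w, tau (k + l) w = tau k (tau l w).
Hypothesis tau_ergodic : ergodic_action P tau.

Lemma probability_bigcap1 (A : (set Omega)^nat) :
  (forall n, measurable (A n)) -> (forall n, P (A n) = 1%E) ->
  P (\bigcap_n A n) = 1%E.
Proof.
move=> mA PA.
have mcap : measurable (\bigcap_n A n) by exact: bigcapT_measurable.
have PC n : P (~` A n) = 0%E by rewrite probability_setC// PA subee.
have : P (~` \bigcap_n A n) = 0%E.
  apply/negligibleP; first exact: measurableC.
  rewrite setC_bigcap; apply: negligible_bigcup => n.
  apply/negligibleP; first exact: measurableC.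
  exact: PC.
rewrite probability_setC// => /eqP; rewrite sube_eq ?fin_num_measure//.
by rewrite add0e => /eqP <-.
Qed.

(** A single [m] serves as bound and as Lipschitz constant, so that one increasing family of events
    has to be handled. *)
Definition bounded_lipschitz_set (v : 'rV[R]_d -> Omega -> R) (m : R) : set Omega :=
  [set w | forall x z, `|v x w - v z w| <= m * `|x - z| /\ `|v x w| <= m].

Lemma bounded_lipschitz_set_measurable v (m : R) : 0 <= m -> random_field v ->
  (forall w, exists L : R, 0 <= L /\ forall x z, `|v x w - v z w| <= L * `|x - z|) ->
  measurable (bounded_lipschitz_set v m).
Proof.
move=> m0 mv vlip.
(* By continuity it suffices to test rational points. *)
pose Q (pq : 'rV[rat]_d * 'rV[rat]_d) : set Omega :=
  let x := map_mx ratr pq.1 in let z := map_mx ratr pq.2 in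
  [set w | `|v x w - v z w| <= m * `|x - z|] `&` [set w | `|v x w| <= m].
have mQ pq : measurable (Q pq).
  have mle (F : Omega -> R) c : measurable_fun setT F -> measurable [set w | F w <= c].
    move=> mF; rewrite -[X in measurable X]setTI.
    by apply: (measurable_fun_ler mF (measurable_cst c)).
  apply: measurableI; apply: mle.
    by apply: measurableT_comp => //; apply: measurable_funB; exact: mv.
  by apply: measurableT_comp => //; exact: mv.
(* Pairs of rational points are enumerated by [unpickle]; an integer that codes no pair contributes
   the whole space. *)
have -> : bounded_lipschitz_set v m =
    \bigcap_n (if unpickle n is Some pq then Q pq else setT).
  apply/seteqP; split=> w.
    move=> wA n _; case: (unpickle n) => [[p q]|//].
    have [h1 h2] := wA (map_mx ratr p) (map_mx ratr q).
    by split.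
  move=> wQ.
  have {}wQ p q : Q (p, q) w by have := wQ (pickle (p, q)) I; rewrite pickleK.
  have [L [L0 wL]] := vlip w.
  (* Moving both points to rational ones at distance [s] costs [2 * L * s] in the values of [v] and
     [2 * m * s] in the distance; the 1 keeps the divisor positive. *)
  have c0 : 0 < 2 * L + 2 * m + 1 by lra.
  move=> x z; split; apply/ler_addgt0Pr => e e0.
    pose s := e / (2 * L + 2 * m + 1).
    have s0 : 0 < s by rewrite divr_gt0.
    have sE : s * (2 * L + 2 * m + 1) = e by rewrite divfK// gt_eqF.
    have [p xp] := rational_vector_near x s0.
    have [q zq] := rational_vector_near z s0.
    have [/= pq _] := wQ p q.
    set p' := map_mx ratr p in xp pq; set q' := map_mx ratr q in zq pq.
    have h1 : L * `|x - p'| <= L * s by rewrite ler_wpM2l// ltW.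
    have h2 : L * `|z - q'| <= L * s by rewrite ler_wpM2l// ltW.
    have h3 : `|p' - q'| <= s + (`|x - z| + s).
      rewrite (le_trans (ler_distD x _ _))// lerD//; first by rewrite distrC ltW.
      by rewrite (le_trans (ler_distD z _ _))// lerD2l ltW.
    have h4 : m * `|p' - q'| <= m * (s + (`|x - z| + s)) by rewrite ler_wpM2l.
    have := wL x p'; have := wL z q'; rewrite (distrC (v z w)) => h5 h6.
    have := ler_distD (v p' w) (v x w) (v z w).
    have := ler_distD (v q' w) (v p' w) (v z w).
    by lra.
  pose s := e / (2 * L + 2 * m + 1).
  have s0 : 0 < s by rewrite divr_gt0.
  have sE : s * (2 * L + 2 * m + 1) = e by rewrite divfK// gt_eqF.
  have [p xp] := rational_vector_near x s0.
  have [/= _ pm] := wQ p p.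
  have := wL x (map_mx ratr p).
  have : L * `|x - map_mx ratr p| <= L * s by rewrite ler_wpM2l// ltW.
  have := ler_normD (v x w - v (map_mx ratr p) w) (v (map_mx ratr p) w).
  rewrite subrK.
  have : 0 <= m * s by rewrite mulr_ge0// ltW.
  by lra.
apply: bigcapT_measurable => n; case: (unpickle n) => [pq|] /=; first exact: mQ.
exact: measurableT.
Qed.

Lemma bounded_lipschitz_set_invariant v (m : R) : Zd_stationary tau v ->
  forall k, tau k @` bounded_lipschitz_set v m = bounded_lipschitz_set v m.
Proof.
move=> vstat.
have tau_in k w : bounded_lipschitz_set v m w -> bounded_lipschitz_set v m (tau k w).
  move=> wA x z; rewrite -!vstat.
  have [] := wA (x + intvec R k) (z + intvec R k).
  by rewrite opprD addrACA subrr addr0.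
move=> k; apply/seteqP; split=> w.
  by case=> w' /tau_in + <-; exact.
move=> wA; exists (tau (- k) w); first exact: tau_in.
by rewrite -tauD subrr tau0.
Qed.

(** The events for integer [m] are invariant, hence of probability 0 or 1. They cover the whole
    space, so they cannot all be null. *)
Lemma ergodic_uniform_bounds v : random_field v -> Zd_stationary tau v ->
  (forall w, bounded_fun (fun x => v x w)) ->
  (forall w, exists L : R, 0 <= L /\ forall x z, `|v x w - v z w| <= L * `|x - z|) ->
  exists m : R, [/\ 0 <= m, measurable (bounded_lipschitz_set v m) &
    P (bounded_lipschitz_set v m) = 1%E].
Proof.
move=> mv vstat vbnd vlip.
have mA (n : nat) : measurable (bounded_lipschitz_set v n%:R).
  exact: bounded_lipschitz_set_measurable.
apply: contrapT => no_m.
have PA0 (n : nat) : P (bounded_lipschitz_set v n%:R) = 0%E.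
  have [//|PA1] := tau_ergodic (mA n) (bounded_lipschitz_set_invariant n%:R vstat).
  by exfalso; apply: no_m; exists n%:R; split => //; exact: mA.
have : P.-negligible (\bigcup_n bounded_lipschitz_set v n%:R).
  apply: negligible_bigcup => n; apply/negligibleP; [exact: mA|exact: PA0].
have -> : \bigcup_n bounded_lipschitz_set v n%:R = setT.
  apply/seteqP; split=> // w _.
  have [L [L0 wL]] := vlip w; have [M [_ wM]] := vbnd w.
  (* [bounded_fun] provides a bound only for numbers strictly above [M], hence [M + 1]. *)
  pose m := Num.max L (M + 1).
  have [n mn] : exists n : nat, m <= n%:R.
    by exists (Num.truncn m).+1; exact/ltW/truncnS_gt.
  exists n => //= x z; split.
    rewrite (le_trans (wL x z))// ler_wpM2r// (le_trans _ mn)//.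
    by rewrite /m le_max lexx.
  rewrite (le_trans _ mn)// (@le_trans _ _ (M + 1)) ?le_max ?lexx ?orbT//.
  by apply: wM => //; rewrite ltrDl.
move=> /negligibleP => /(_ measurableT) PT0.
by have := probability_setT P; rewrite PT0 => /esym/eqP; rewrite onee_eq0.
Qed.

End ergodic_bounds.

Lemma lipschitz_nonneg_constant (R : realType) (V : normedModType R) (u : V -> R)
    (L : R) : L.-lipschitz u ->
  forall x z, `|u x - u z| <= Num.max L 0 * `|x - z|.
Proof.
move=> uL x z; have := uL (x, z) (conj I I) => /= /le_trans; apply.
by rewrite ler_wpM2r// le_max lexx.
Qed.

Lemma ae_nonempty (R : realType) (disp : measure_display)
    (T : measurableType disp) (P : probability T R) (Q : T -> Prop) :
  {ae P, forall w, Q w} -> exists w, Q w.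
Proof.
move=> aeQ; apply: contrapT => noQ.
have : P.-negligible [set: T].
  have -> : [set: T] = ~` [set w | Q w]; last exact: aeQ.
  by apply/seteqP; split => // w _ /= Qw; apply: noQ; exists w.
move=> /negligibleP => /(_ measurableT) PT0.
by have := probability_setT P; rewrite PT0 => /esym/eqP; rewrite onee_eq0.
Qed.

(** * Passage to the limit in the discount *)

Theorem theorem3p3 (R : realType) (d : nat)
  (H : 'rV[R]_d -> 'rV[R]_d -> R)
  (H_C2 : is_C2 (fun px : 'rV[R]_d * 'rV[R]_d => H px.1 px.2))
  (H_periodic : forall p, Zd_periodic (H p))
  (H_convex : forall p x, posdef (hessian (fun q => H q x) p))
  (H_superlinear : superlinear H)
  (disp : measure_display) (Omega : measurableType disp)
  (P : probability Omega R)
  (tau : 'rV[int]_d -> Omega -> Omega)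
  (tau_mp : measure_preserving_action P tau)
  (tau_ergodic : ergodic_action P tau)
  (f : 'rV[R]_d -> Omega -> R)
  (f_random : random_field f)
  (f_ge0 : forall x w, 0 <= f x w)
  (f_cont : continuous_uniformly_in_omega f)
  (f_stat : Zd_stationary tau f)
  (Hbar Hbarf : R)
  (Hbar_def : is_effective_constant H Hbar)
  (Hbarf_def : is_ergodic_constant P tau H f Hbarf) :
  0 <= Hbar - Hbarf /\
  ((Hbar - Hbarf)%:E <= ereal_sup (range (fun x => 'E_P[f x])))%E.
Proof.
have [tau0 tauD _ _] := tau_mp.
have [[chi [chi_per [chi_cont chi_sub chi_sup]]] _] := Hbar_def.
have [C [C0 chiC]] := periodic_bounded chi_per chi_cont.
have [v [[v_random v_stat v_bnd v_lip v_sol] v_cvg]] := Hbarf_def.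
have Hcont := C2_continuous H_C2.
have vL delta w : 0 < delta -> exists L : R, 0 <= L /\
    forall x z, `|v delta x w - v delta z w| <= L * `|x - z|.
  move=> delta0; have [L wL] := v_lip w; exists (Num.max L 0); split.
    by rewrite le_max lexx orbT.
  exact: (lipschitz_nonneg_constant (wL delta delta0)).
have lower delta w : 0 < delta ->
    - (delta * v delta 0 w) <= Hbar + 2 * delta * C.
  move=> delta0; have [L [L0 wL]] := vL delta w delta0.
  have [M [_ wM]] := v_bnd delta w delta0.
  have [w_cont _ w_sup] := v_sol delta w delta0.
  apply: (@discounted_lower_bound _ _ H Hcont H_periodic chi (fun x => v delta x w)
    (f^~ w) Hbar C L (M + 1) delta) => // x.
  by apply: wM => //; rewrite ltrDl.
split.
  (* [lower] holds for every [w], so a single [w] at which the limit exists is enough. *)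
  have [w wcvg] := ae_nonempty v_cvg.
  rewrite subr_ge0; apply/ler_addgt0Pr => e e0.
  apply: (@closed_cvg _ _ (0^'+) _ _ [set t | t <= Hbar + e] _ _ _ wcvg).
    exact: closed_le.
  have s0 : 0 < e / (2 * C + 1) by rewrite divr_gt0//; lra.
  near=> delta; rewrite /=.
  have delta0 : 0 < delta by near: delta; exact: nbhs_right_gt.
  have : delta < e / (2 * C + 1) by near: delta; exact: nbhs_right_lt.
  rewrite ltr_pdivlMr; last by lra.
  by have := lower delta w delta0; lra.
set M := ereal_sup _.
have EfM x : (\int[P]_w (f x w)%:E <= M)%E.
  have : ('E_P[f x] <= M)%E by apply: ereal_sup_ubound; exists x.
  by rewrite expectation.unlock.
have Ef0 : (0 <= M)%E.
  by apply: le_trans (EfM 0); apply: integral_ge0 => w _; rewrite lee_fin.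
(* If the supremum is infinite the bound is trivial; the value minus infinity is excluded by
   [f_ge0]. *)
case: M EfM Ef0 => [M| |] EfM Ef0 //; last by rewrite leey.
rewrite lee_fin; apply/ler_addgt0Pr => e e0.
pose s := e / (2 * C + 1).
have s0 : 0 < s by rewrite divr_gt0//; lra.
have sE : s * (2 * C + 1) = e by rewrite divfK// gt_eqF//; lra.
(* A sequence of discounts leaves only countably many full events to intersect and suits Fatou's
   lemma; [s] is such that [2 * delta n * C <= e]. *)
pose delta n : R := s / n.+1%:R.
have delta0 n : 0 < delta n by rewrite divr_gt0.
have deltas n : delta n <= s.
  by rewrite ler_pdivrMr// ler_peMr ?ler1n// ltW.
have delta_cvg : delta n @[n --> \oo] --> (0 : R)^'+.
  move=> U [r /= r0 rU].
  have rs0 : 0 < r / s by rewrite divr_gt0.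
  have := near_infty_natSinv_lt (PosNum rs0).
  apply: filterS => n /= nr; apply: rU => //=.
  rewrite sub0r normrN gtr0_norm// /delta mulrC -ltr_pdivlMr//.
have /choice[m mP] n := ergodic_uniform_bounds tau0 tauD tau_ergodic
  (v_random _ (delta0 n)) (v_stat _ (delta0 n)) (v_bnd _ ^~ (delta0 n))
  (fun w => vL _ w (delta0 n)).
have [N [mN PN0 cvgN]] := v_cvg.
(* Index 0 is reserved for the convergence event, index [k.+1] for the bounds on [v (delta k)]. *)
pose F n := if n is k.+1 then bounded_lipschitz_set (v (delta k)) (m k) else ~` N.
have mF n : measurable (F n).
  by case: n => [|n] /=; [exact: measurableC|case: (mP n)].
pose A := \bigcap_n F n.
have mA : measurable A by exact: bigcapT_measurable.
have PA : P A = 1%E.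
  apply: probability_bigcap1 => // -[|n] /=; last by case: (mP n).
  by rewrite probability_setC// PN0 sube0.
have AB n w : A w -> bounded_lipschitz_set (v (delta n)) (m n) w.
  by move=> /(_ n.+1 I).
have A_cvg w : A w -> - (delta n * v (delta n) 0 w) @[n --> \oo] --> Hbarf.
  move=> Aw; have : - (t * v t 0 w) @[t --> 0^'+] --> Hbarf.
    by apply: contrapT => ncvg; apply: (Aw 0 I); exact: cvgN.
  by apply: cvg_comp.
have f_intT x : P.-integrable setT (EFin \o f x).
  apply/integrableP; split; first by apply/measurable_EFinP; exact: f_random.
  under eq_integral do rewrite /= ger0_norm//.
  by rewrite (le_lt_trans (EfM x))// ltry.
have f_int x : P.-integrable A (EFin \o f x).
  exact: (integrableS measurableT mA _ (f_intT x)).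
have f_mean x : \int[P]_(w in A) f x w <= M.
  rewrite -lee_fin /Rintegral fineK; last exact: (integrable_fin_num mA (f_int x)).
  apply: le_trans (EfM x); apply: ge0_subset_integral => //.
    by apply/measurable_EFinP; exact: f_random.
  by move=> w _; rewrite lee_fin.
have upper n : delta n * \int[P]_(w in A) v (delta n) 0 w <=
    M - Hbar + 2 * delta n * C.
  have [m0 _ _] := mP n.
  apply: (@averaged_upper_bound _ _ _ _ P A mA PA H H_C2 H_periodic H_convex
    (v (delta n)) f chi Hbar C (m n) (m n) M (delta n)) => //.
  - exact: v_random.
  - by move=> w Aw x z; have [] := AB n w Aw x z.
  - by move=> w Aw x; have [] := AB n w Aw x x.
  - by move=> w _; have [] := v_sol (delta n) w (delta0 n).
  - by move=> w _; have [] := v_sol (delta n) w (delta0 n).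
  - exact: stationary_uniform_modulus f_stat f_cont tau0 tauD.
(* By [lower], adding [B] makes [delta n * v (delta n) 0 w] nonnegative for all [n], as Fatou's
   lemma requires. *)
pose B := Hbar + 2 * s * C.
pose g n w := B + delta n * v (delta n) 0 w.
have g_ge0 n w : 0 <= g n w.
  have := lower _ w (delta0 n).
  have : delta n * C <= s * C by rewrite ler_wpM2r.
  by rewrite /g /B; lra.
have v_int n : P.-integrable A (EFin \o v (delta n) 0).
  apply: (@integrable_bounded_on _ _ _ P A mA _ (m n)).
    exact: v_random.
  by move=> w Aw; have [] := AB n w Aw 0 0.
have g_mean n : (\int[P]_(w in A) (g n w)%:E <= (B + (M - Hbar + 2 * s * C))%:E)%E.
  have g_int : P.-integrable A (EFin \o g n).
    by apply: integrable_add => //; [exact: integrable_const|exact: integrable_scale].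
  rewrite -[leLHS]fineK; last exact: (integrable_fin_num mA g_int).
  rewrite lee_fin -/(Rintegral P A (g n)) RintegralD//; first last.
  - exact: integrable_scale.
  - exact: integrable_const.
  rewrite (Rintegral_const mA PA) RintegralZl// lerD2l (le_trans (upper n))//.
  by rewrite lerD2l ler_wpM2r// ler_pM2l.
have g_lim : (\int[P]_(w in A) limn_einf (fun n => (g n w)%:E) = (B - Hbarf)%:E)%E.
  transitivity (\int[P]_(w in A) (B - Hbarf)%:E)%E; last first.
    transitivity ((B - Hbarf)%:E * P A)%E; first exact: integral_cst.
    by rewrite PA mule1.
  apply: eq_integral => w /set_mem Aw.
  apply: (cvg_limn_einf_sup _).1; apply: cvg_EFin; first exact: nearW.
  have -> : fine \o (fun n => (g n w)%:E) =
      (fun n => B - (- (delta n * v (delta n) 0 w))).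
    by apply/funext => n /=; rewrite opprK.
  by apply: cvgB; [exact: cvg_cst|exact: A_cvg].
have : ((B - Hbarf)%:E <= (B + (M - Hbar + 2 * s * C))%:E)%E.
  rewrite -g_lim.
  apply: (le_trans (@fatou _ _ _ P A mA (fun n w => (g n w)%:E) _ _)).
  - move=> n; apply/measurable_EFinP; apply: measurable_funTS.
    apply: measurable_funD; first exact: measurable_cst.
    by apply: measurable_funM; [exact: measurable_cst|exact: v_random].
  - by move=> n w _; rewrite lee_fin.
  - exact: limn_einf_le.
by rewrite lee_fin; lra.
Unshelve. all: by end_near. Qed.
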